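(* Let $M \xrightarrow{R} A$ be a relative Rota-Baxter algebra and $(N \xrightarrow{S} B, l, r)$ a bimodule over it. Equip $A\oplus B$ with the semidirect product $$(a,b)\cdot_\ltimes(a',b')=(a\cdot a',\ a\cdot_B b'+b\cdot_B a'),$$ and $M\oplus N$ with the left and right $(A\oplus B)$-actions $$(a,b)\vartriangleright(m,n)=(a\cdot_M m,\ a\cdot_N n+r(b,m)),\qquad (m,n)\vartriangleleft(a,b)=(m\cdot_M a,\ l(m,b)+n\cdot_N a).$$ Then $M\oplus N\xrightarrow{R\oplus S}A\oplus B$ is a relative Rota-Baxter algebra, where $(R\oplus S)(m,n)=(R(m),S(n))$.
   Context: All vector spaces and (multi)linear maps are over a field $\mathbf{k}$ of characteristic $0$. Associative algebras need not be unital. For an associative algebra $A$, an $A$-bimodule is a vector space $M$ with bilinear maps $A\otimes M\to M$, $(a,m)\mapsto a\cdot_M m$, and $M\otimes A\to M$, $(m,a)\mapsto m\cdot_M a$, with $(a\cdot a')\cdot_M m=a\cdot_M(a'\cdot_M m)$, $(a\cdot_M m)\cdot_M a'=a\cdot_M(m\cdot_M a')$, $(m\cdot_M a)\cdot_M a'=m\cdot_M(a\cdot a')$. A relative Rota-Baxter algebra $M\xrightarrow{R}A$ consists of an associative algebra $A$, an $A$-bimodule $M$ and a linear map $R:M\to A$ (a relative Rota-Baxter operator) with $R(m)\cdot R(m')=R(R(m)\cdot_M m'+m\cdot_M R(m'))$ for all $m,m'\in M$. A bimodule over $M\xrightarrow{R}A$ is a tuple $(N\xrightarrow{S}B,l,r)$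 in which $S:N\to B$ is a linear map ($2$-term chain complex), $B$ and $N$ are both $A$-bimodules, and $l:M\otimes B\to N$, $r:B\otimes M\to N$ are bilinear maps such that for all $a\in A,b\in B,m\in M,n\in N$: - $l(a\cdot_M m,b)=a\cdot_N l(m,b)$, $l(m\cdot_M a,b)=l(m,a\cdot_B b)$, $l(m,b\cdot_B a)=l(m,b)\cdot_N a$; - $r(a\cdot_B b,m)=a\cdot_N r(b,m)$, $r(b\cdot_B a,m)=r(b,a\cdot_M m)$, $r(b,m\cdot_M a)=r(b,m)\cdot_N a$; - $R(m)\cdot_B S(n)=S(R(m)\cdot_N n+l(m,S(n)))$, $S(n)\cdot_B R(m)=S(r(S(n),m)+n\cdot_N R(m))$. *)

(* Defs.v *)
From HB Require Import structures.
From mathcomp Require Import all_boot all_order all_algebra.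

Set Implicit Arguments.
Unset Strict Implicit.
Unset Printing Implicit Defensive.

Import GRing.Theory.
Local Open Scope ring_scope.

(* MathComp's algebra structures are unital, whereas the algebras here need not
   have a unit: an algebra is a module over [k] together with an explicit
   multiplication, and the structures below are predicates on such operations. *)

Notation is_bilinear f := (bilinear_for *:%R *:%R f).

Record is_assoc_algebra (k : fieldType) (A : lmodType k) (mul : A -> A -> A) :
    Prop := IsAssocAlgebra {
  assoc_algebra_bilinear : is_bilinear mul;
  assoc_algebra_assoc : associative mul
}.

Record is_bimodule (k : fieldType) (A M : lmodType k) (mul : A -> A -> A)
    (lact : A -> M -> M) (ract : M -> A -> M) : Prop := IsBimodule {
  bimodule_lact_bilinear : is_bilinear lact;
  bimodule_ract_bilinear : is_bilinear ract;
  bimodule_lactA : forall a a' m, lact (mul a a') m = lact a (lact a' m);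
  bimodule_lractA : forall a m a', ract (lact a m) a' = lact a (ract m a');
  bimodule_ractA : forall m a a', ract (ract m a) a' = ract m (mul a a')
}.

Record is_relative_rota_baxter_algebra (k : fieldType) (A M : lmodType k)
    (mul : A -> A -> A) (lact : A -> M -> M) (ract : M -> A -> M)
    (R : M -> A) : Prop := IsRelativeRotaBaxterAlgebra {
  rrb_algebra : is_assoc_algebra mul;
  rrb_bimodule : is_bimodule mul lact ract;
  rrb_linear : linear R;
  rrb_identity : forall m m',
    mul (R m) (R m') = R (lact (R m) m' + ract m (R m'))
}.

(* The tuple (S : N -> B, l, r) is a bimodule over R : M -> A, where [lactB],
   [ractB], [lactN], [ractN] are the A-actions on B and N. *)
Record is_relative_rota_baxter_bimodule (k : fieldType) (A M B N : lmodType k)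
    (mul : A -> A -> A) (lactM : A -> M -> M) (ractM : M -> A -> M)
    (R : M -> A)
    (lactB : A -> B -> B) (ractB : B -> A -> B)
    (lactN : A -> N -> N) (ractN : N -> A -> N)
    (S : N -> B) (l : M -> B -> N) (r : B -> M -> N) : Prop :=
    IsRelativeRotaBaxterBimodule {
  rrb_bimod_linear : linear S;
  rrb_bimod_B : is_bimodule mul lactB ractB;
  rrb_bimod_N : is_bimodule mul lactN ractN;
  rrb_bimod_l_bilinear : is_bilinear l;
  rrb_bimod_r_bilinear : is_bilinear r;
  rrb_bimod_l_lactM : forall a m b, l (lactM a m) b = lactN a (l m b);
  rrb_bimod_l_ractM : forall m a b, l (ractM m a) b = l m (lactB a b);
  rrb_bimod_l_ractB : forall m b a, l m (ractB b a) = ractN (l m b) a;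
  rrb_bimod_r_lactB : forall a b m, r (lactB a b) m = lactN a (r b m);
  rrb_bimod_r_ractB : forall b a m, r (ractB b a) m = r b (lactM a m);
  rrb_bimod_r_ractM : forall b m a, r b (ractM m a) = ractN (r b m) a;
  rrb_bimod_lactB_S : forall m n,
    lactB (R m) (S n) = S (lactN (R m) n + l m (S n));
  rrb_bimod_ractB_S : forall n m,
    ractB (S n) (R m) = S (r (S n) m + ractN n (R m))
}.

Section SemidirectProduct.

Variables (k : fieldType) (A M B N : lmodType k).
Variables (mul : A -> A -> A) (lactM : A -> M -> M) (ractM : M -> A -> M).
Variables (lactB : A -> B -> B) (ractB : B -> A -> B).
Variables (lactN : A -> N -> N) (ractN : N -> A -> N).
Variables (l : M -> B -> N) (r : B -> M -> N).

Definition semidirect_mul (x y : A * B) : A * B :=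
  (mul x.1 y.1, lactB x.1 y.2 + ractB x.2 y.1).

Definition semidirect_lact (x : A * B) (u : M * N) : M * N :=
  (lactM x.1 u.1, lactN x.1 u.2 + r x.2 u.1).

Definition semidirect_ract (u : M * N) (x : A * B) : M * N :=
  (ractM u.1 x.1, l u.1 x.2 + ractN u.2 x.1).

Definition direct_sum_map (R : M -> A) (S : N -> B) (u : M * N) : A * B :=
  (R u.1, S u.2).

End SemidirectProduct.

(* Main.v *)
Require Import Defs.
From HB Require Import structures.
From mathcomp Require Import all_boot all_order all_algebra.
Import GRing.Theory.
Local Open Scope ring_scope.

(** Give [A] and [M] degree 0, [B] and [N] degree 1, and let products of two degree 1 elements
    vanish. The degree 0 component of each required identity is the same identity for [R]. Its
    degree 1 component is a sum over which single argument is taken in [B] or [N], and each summand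
    is one of the bimodule axioms. Bilinearity of all three operations comes from
    [is_bilinear_triangular]. *)

Section Bilinear.

Variables (k : fieldType) (U V W : lmodType k) (f : U -> V -> W).
Hypothesis f_bilinear : is_bilinear f.

Lemma is_bilinearDl u u' v : f (u + u') v = f u v + f u' v.
Proof. by have := f_bilinear.1 v 1 u u'; rewrite /= !scale1r. Qed.

Lemma is_bilinearDr u v v' : f u (v + v') = f u v + f u v'.
Proof. by have := f_bilinear.2 u 1 v v'; rewrite /= !scale1r. Qed.

End Bilinear.

Arguments is_bilinearDl {k U V W f}.
Arguments is_bilinearDr {k U V W f}.

(** Common shape of [semidirect_mul] and both actions: [(g, h)] is [(lactB, ractB)], [(lactN, r)] or
    [(l, ractN)]. *)
Lemma is_bilinear_triangular (k : fieldType) (U U' V V' W W' : lmodType k)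
    (f : U -> V -> W) (g : U -> V' -> W') (h : U' -> V -> W') :
  is_bilinear f -> is_bilinear g -> is_bilinear h ->
  is_bilinear (fun (x : U * U') (y : V * V') =>
    (f x.1 y.1, g x.1 y.2 + h x.2 y.1) : W * W').
Proof.
move=> [fl fr] [gl gr] [hl hr]; split=> [y c x x' | x c y y'] /=.
  congr pair; first exact: fl.
  by rewrite [g _ _](gl y.2) [h _ _](hl y.1) /= scalerDr addrACA.
congr pair; first exact: fr.
by rewrite [g _ _](gr x.1) [h _ _](hr x.2) /= scalerDr addrACA.
Qed.

Theorem proposition3p9 (k : fieldType) (pchar_k : [pchar k] =i pred0)
    (A M B N : lmodType k)
    (mul : A -> A -> A) (lactM : A -> M -> M) (ractM : M -> A -> M)
    (R : M -> A)
    (lactB : A -> B -> B) (ractB : B -> A -> B)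
    (lactN : A -> N -> N) (ractN : N -> A -> N)
    (S : N -> B) (l : M -> B -> N) (r : B -> M -> N) :
  is_relative_rota_baxter_algebra mul lactM ractM R ->
  is_relative_rota_baxter_bimodule mul lactM ractM R
    lactB ractB lactN ractN S l r ->
  is_relative_rota_baxter_algebra
    (semidirect_mul mul lactB ractB)
    (semidirect_lact lactM lactN r)
    (semidirect_ract ractM ractN l)
    (direct_sum_map R S).
Proof.
move=> [[mul_bil mulA] bimM R_lin RB] [S_lin bimB bimN l_bil r_bil].
move=> l_lactM l_ractM l_ractB r_lactB r_ractB r_ractM lactB_S ractB_S.
have [lM_bil rM_bil lM_A lM_rM rM_A] := bimM.
have [lB_bil rB_bil lB_A lB_rB rB_A] := bimB.
have [lN_bil rN_bil lN_A lN_rN rN_A] := bimN.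
split; first split; last 3 first.
- split.
  + exact: is_bilinear_triangular.
  + exact: is_bilinear_triangular.
  + move=> a a' m; congr pair => /=; first exact: lM_A.
    (* Both sides expand to three terms, with the degree 1 entry in [m], [a'] or [a]; one axiom
       matches each pair. *)
    rewrite (is_bilinearDl r_bil) (is_bilinearDr lN_bil).
    by rewrite lN_A r_lactB r_ractB addrA.
  + move=> a m a'; congr pair => /=; first exact: lM_rM.
    rewrite (is_bilinearDl rN_bil) (is_bilinearDr lN_bil).
    by rewrite lN_rN l_lactM r_ractM addrA.
  + move=> m a a'; congr pair => /=; first exact: rM_A.
    rewrite (is_bilinearDl rN_bil) (is_bilinearDr l_bil).
    by rewrite rN_A l_ractM l_ractB addrA.
- by move=> c u v; congr pair; [exact: R_lin | exact: S_lin].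
- move=> u v; congr pair => /=; first exact: RB.
  have SD n n' : S (n + n') = S n + S n'.
    by have := S_lin 1 n n'; rewrite !scale1r.
  (* The two axioms on [S] pair each action on [N] with [l] or [r]; [addrACA] regroups the four
     terms by left and right action of the sum. *)
  by rewrite lactB_S ractB_S -SD addrACA.
- exact: is_bilinear_triangular.
- move=> x y z; congr pair => /=; first exact: mulA.
  rewrite (is_bilinearDr lB_bil) (is_bilinearDl rB_bil).
  by rewrite lB_A lB_rB rB_A addrA.
Qed.
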